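(* Let $A$ be a nonempty finite subset of an abelian group $\Gamma$, and define $K,M$ by $\mathsf{E}(A)=|A|^3/K$ and $\mathsf{E}_3(A)=M|A|^4/K^2$. Then there is a set $A'\subseteq A$ such that $$|A'|\gg M^{-10}\log^{-15}(4M)\cdot|A|$$ and $$|nA'-mA'|\ll\big(M^9\log^{14}(4M)\big)^{6(n+m)}K|A'|$$ for all positive integers $n,m$, with absolute implied constants.
   Context: $\mathsf{E}(A)=\sum_x|A\cap(A-x)|^2$ and $\mathsf{E}_3(A)=\sum_x|A\cap(A-x)|^3$ (one always has $M\ge1$). $nA'-mA'=\{a_1+\dots+a_n-b_1-\dots-b_m: a_i,b_j\in A'\}$. Logarithms are to base $2$. *)

(* Defs.v *)
From HB Require Import structures.
From mathcomp Require Import all_boot all_order all_algebra finmap.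
From mathcomp Require Import all_classical all_reals all_analysis.

Set Implicit Arguments.
Unset Strict Implicit.
Unset Printing Implicit Defensive.

Import Order.TTheory GRing.Theory Num.Theory.

Local Open Scope ring_scope.

Definition translate (G : zmodType) (A : {fset G}) (x : G) : {fset G} :=
  [fset a - x | a in A]%fset.

(* The sum runs over the whole, possibly infinite, group; its support is
   contained in A - A, hence finite (see [energyE]).  [energy 2] is E and
   [energy 3] is E_3. *)
Definition energy (G : zmodType) (k : nat) (A : {fset G}) : nat :=
  \big[addn/0%N]_(x \in [set: G]) (#|` A `&` translate A x|%fset ^ k)%N.

Definition sumdiff (G : zmodType) (n m : nat) (A : {fset G}) : {fset G} :=
  [fset \sum_(i < n) val (a i) - \sum_(j < m) val (b j)
     | a : {ffun 'I_n -> A} in predT, b : {ffun 'I_m -> A} in predT]%fset.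

Definition log2 (R : realType) (x : R) : R := ln x / ln 2.

Lemma energyE (G : zmodType) (k : nat) (A : {fset G}) : (0 < k)%N ->
  energy k A = (\sum_(x <- [fset (a - b)%R | a in A, b in A]%fset)
                  #|` A `&` translate A x|%fset ^ k)%N.
Proof.
move=> k0; rewrite /energy (fsbigE [fset a - b | a in A, b in A]%fset) //=.
- by apply: eq_bigl => x; rewrite in_setT.
- move=> x _ xAA; suff -> : (A `&` translate A x = fset0)%fset.
    by rewrite cardfs0 exp0n.
  apply/fsetP => a; rewrite in_fset0; apply/negbTE; apply: contra xAA.
  rewrite in_fsetI => /andP[aA /imfsetP[b /= bA ab]].
  by apply/imfset2P; exists b => //; exists a => //; rewrite ab subKr.
Qed.

Lemma sumdiffP (G : zmodType) (n m : nat) (A : {fset G}) (x : G) :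
  reflect (exists (a : 'I_n -> G) (b : 'I_m -> G),
    [/\ forall i, a i \in A, forall j, b j \in A
      & x = \sum_(i < n) a i - \sum_(j < m) b j])
   (x \in sumdiff n m A).
Proof.
apply: (iffP (imfset2P _ _ _ _ _)) => [[a _ [b _ ->]]|[a [b [aA bA ->]]]].
  by exists (fun i => val (a i)), (fun j => val (b j)); split=> // i; exact: valP.
exists [ffun i => [` aA i]%fset] => //; exists [ffun j => [` bA j]%fset] => //.
by congr (_ - _); apply: eq_bigr => i _; rewrite ffunE.
Qed.

(* Main.v *)
(* Write N = |A|, r(x) = |A \cap (A - x)| and D = A - A, so that r has r-weighted mean N/K on D.
   The matrix (r(b - c)) indexed by A is positive semidefinite, so the sum of
   r(a-b) r(a-c) r(b-c) over A^3 is >> N^6/K^3, and this survives truncating the first two factors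
   at 4 M N/K (u below) and the third at 144 M^3 N/K (v below). Since E_3 counts the pairs of
   triples with the same differences (a-b, a-c), Cauchy-Schwarz turns this into a lower bound for
   the sum of u(x)^2 u(y)^2 v(y-x)^2 over x, y in D, which loses only M^{-1}. A weighted
   Balog-Szemeredi-Gowers argument, with measure u^2/E on both sides and edge weights v(y-x)^2,
   gives X, Y in D with |X - Y| << M^30 |Y|; no dyadic decomposition is needed because the v^2
   have total mass at most E. Averaging gives a translate of X meeting A in a set A' of size
   >> M^{-8} N, and A' - Y sits in a translate of X - Y, so that Plunnecke's inequality applies.
   The powers of the logarithm only absorb the constant of |X - Y| << M^30 |Y|. For M <= 5/4 one
   has log(4M) >= 2, and a variance bound makes that constant smaller than 2^84; for M >= 5/4 one
   has log(4M) >= 9/4. *)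
Require Import Defs.
From HB Require Import structures.
From mathcomp Require Import all_boot all_order all_algebra finmap.
From mathcomp Require Import all_classical all_reals all_analysis.
From mathcomp Require Import ring lra.

Set Implicit Arguments.
Unset Strict Implicit.
Unset Printing Implicit Defensive.

Import Order.TTheory GRing.Theory Num.Theory.

Local Open Scope ring_scope.

Ltac positivity := repeat match goal with
  | H : is_true (Order.lt _ ?x) |- is_true (Order.lt _ ?x) => exact: H
  | |- is_true (Order.lt _ (GRing.inv _)) => rewrite invr_gt0
  | |- is_true (Order.lt _ (GRing.mul _ _)) => apply: mulr_gt0
  | |- is_true (Order.lt _ (GRing.exp _ _)) => apply: exprn_gt0
  | |- is_true (Order.lt _ (GRing.natmul _ _)) => by rewrite ltr0n
  | |- is_true (Order.lt _ (GRing.one _)) => exact: ltr01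
  | |- is_true (Order.le _ _) => apply: ltW
  end.

(** * Sums and the weighted Balog-Szemeredi-Gowers lemma *)

(** Lagrange's identity: twice the gap between the two sides is the double sum of
    [(f i * g j - f j * g i) ^+ 2]. *)
Lemma cauchy_schwarz_sum (R : realFieldType) (I : Type) (s : seq I) (f g : I -> R) :
  (\sum_(i <- s) f i * g i) ^+ 2 <=
  (\sum_(i <- s) f i ^+ 2) * (\sum_(i <- s) g i ^+ 2).
Proof.
rewrite -subr_ge0 -(@pmulr_rge0 _ 2)//.
suff -> : 2 * ((\sum_(i <- s) f i ^+ 2) * (\sum_(i <- s) g i ^+ 2) -
    (\sum_(i <- s) f i * g i) ^+ 2) =
    \sum_(i <- s) \sum_(j <- s) (f i * g j - f j * g i) ^+ 2.
  by rewrite sumr_ge0// => i _; rewrite sumr_ge0// => j _; rewrite sqr_ge0.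
rewrite mulrBr {1}mulr_natl mulr2n [X in _ + X - _]mulrC expr2 !big_distrlr /=.
rewrite mulr_sumr -big_split -sumrB; apply: eq_bigr => i _ /=.
rewrite mulr_sumr -big_split -sumrB; apply: eq_bigr => j _ /=; ring.
Qed.

Lemma cauchy_schwarz_sum2 (R : realFieldType) (I J : Type) (s : seq I)
    (t : seq J) (f g : I -> J -> R) :
  (\sum_(i <- s) \sum_(j <- t) f i j * g i j) ^+ 2 <=
  (\sum_(i <- s) \sum_(j <- t) f i j ^+ 2) *
  (\sum_(i <- s) \sum_(j <- t) g i j ^+ 2).
Proof.
have E (F : I -> J -> R) : \sum_(i <- s) \sum_(j <- t) F i j =
    \sum_(p <- [seq (i, j) | i <- s, j <- t]) F p.1 p.2 by rewrite big_allpairs.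
by rewrite !E; exact: cauchy_schwarz_sum.
Qed.

Lemma ler_sum_pred (R : numDomainType) (I : Type) (s : seq I) (P Q : pred I)
    (F : I -> R) :
  (forall i, P i -> Q i) -> (forall i, Q i -> 0 <= F i) ->
  \sum_(i <- s | P i) F i <= \sum_(i <- s | Q i) F i.
Proof.
move=> PQ F0; rewrite [X in X <= _]big_mkcond [X in _ <= X]big_mkcond /=.
apply: ler_sum => i _; case: ifPn => [/PQ ->//|_].
by case: ifPn => // /F0.
Qed.

Section BalogSzemerediGowers.
Variables (R : realFieldType) (I J : Type) (s : seq I) (t : seq J).
Variables (mu : I -> R) (nu : J -> R) (g : I -> J -> R) (d : R).
Hypotheses (mu0 : forall x, 0 <= mu x) (nu0 : forall y, 0 <= nu y).
Hypotheses (g01 : forall x y, 0 <= g x y <= 1).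
Hypotheses (mu1 : \sum_(x <- s) mu x <= 1) (nu1 : \sum_(y <- t) nu y <= 1).
Hypothesis d0 : 0 < d.
Hypothesis dg : d <= \sum_(x <- s) \sum_(y <- t) mu x * nu y * g x y.

(** Read [g] as the edge weights of a bipartite graph on [I] and [J]. The threshold [d / 2] lets low
    degrees cost at most half of the edge weight; [d ^+ 3 / 128] lets poor pairs, penalized by
    [16 / d] in [pivot], cost at most half of the bound in [mass_sq]. *)
Let deg x := \sum_(y <- t) nu y * g x y.
Let codeg x x' := \sum_(y <- t) nu y * g x y * g x' y.
Let high x := d / 2 <= deg x.
Let poor x x' := high x' && (codeg x x' < d ^+ 3 / 128).
Let mass y := \sum_(x <- s | high x) mu x * g x y.
Let poormass x y := \sum_(x' <- s | poor x x') mu x' * g x' y.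

Let g0 x y : 0 <= g x y. Proof. by case/andP: (g01 x y). Qed.
Let g1 x y : g x y <= 1. Proof. by case/andP: (g01 x y). Qed.
Let mug0 x y : 0 <= mu x * g x y. Proof. exact: mulr_ge0. Qed.
Let nug0 x y : 0 <= nu y * g x y. Proof. exact: mulr_ge0. Qed.
Let codeg0 x x' : 0 <= codeg x x'.
Proof. by apply: sumr_ge0 => y _; rewrite !mulr_ge0. Qed.

Let high_sum : d / 2 <= \sum_(x <- s | high x) mu x * deg x.
Proof.
have : d <= \sum_(x <- s) mu x * deg x.
  apply: le_trans dg _; apply: ler_sum => x _; rewrite mulr_sumr.
  by apply: ler_sum => y _; rewrite mulrA.
rewrite (bigID high) /=.
suff : \sum_(x <- s | ~~ high x) mu x * deg x <= d / 2 by lra.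
apply: (@le_trans _ _ (\sum_(x <- s) mu x * (d / 2))).
  apply: (@le_trans _ _ (\sum_(x <- s | ~~ high x) mu x * (d / 2))).
    by apply: ler_sum => x; rewrite -ltNge => /ltW ?; rewrite ler_wpM2l.
  by apply: ler_sum_pred => // x _; rewrite mulr_ge0// divr_ge0 ?ltW.
by rewrite -mulr_suml -[leRHS]mul1r ler_wpM2r// divr_ge0 ?ltW.
Qed.

Let mass_sum : \sum_(y <- t) nu y * mass y = \sum_(x <- s | high x) mu x * deg x.
Proof.
under eq_bigr do rewrite mulr_sumr.
rewrite exchange_big; apply: eq_bigr => x _ /=; rewrite mulr_sumr.
by apply: eq_bigr => y _; ring.
Qed.

Let mass_sq : d ^+ 2 / 4 <= \sum_(y <- t) nu y * mass y ^+ 2.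
Proof.
have m0 y : 0 <= mass y by apply: sumr_ge0.
have h : d / 2 <= \sum_(y <- t) nu y * mass y by rewrite mass_sum.
set S := \sum_(y <- t) nu y * mass y in h.
(* variance of the mass: [mass ^ 2 >= 2 S mass - S ^ 2] *)
have : \sum_(y <- t) nu y * (2 * S * mass y - S ^+ 2) <=
       \sum_(y <- t) nu y * mass y ^+ 2.
  apply: ler_sum => y _; apply: ler_wpM2l => //.
  by have := sqr_ge0 (mass y - S); lra.
have -> : \sum_(y <- t) nu y * (2 * S * mass y - S ^+ 2) =
   2 * S * S - (\sum_(y <- t) nu y) * S ^+ 2.
  have -> : 2 * S * S = \sum_(y <- t) 2 * S * (nu y * mass y).
    by rewrite -mulr_sumr.
  by rewrite mulr_suml -sumrB; apply: eq_bigr => y _; ring.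
have : (\sum_(y <- t) nu y) * S ^+ 2 <= 1 * S ^+ 2 by rewrite ler_wpM2r// sqr_ge0.
have : (d / 2) ^+ 2 <= S ^+ 2 by rewrite ler_sqr ?nnegrE//; have := d0; lra.
lra.
Qed.

(** Summing over [y] first turns the left side into the codegrees of poor pairs, each below
    [d ^+ 3 / 128], averaged against [mu] twice. *)
Let poor_sum : \sum_(y <- t) nu y *
   (\sum_(x <- s | high x) mu x * g x y * poormass x y) <= d ^+ 3 / 128.
Proof.
have e0 : 0 <= d ^+ 3 / 128 by rewrite divr_ge0// exprn_ge0// ltW.
have -> : \sum_(y <- t) nu y *
   (\sum_(x <- s | high x) mu x * g x y * poormass x y) =
   \sum_(x <- s | high x) mu x * \sum_(x' <- s | poor x x') mu x' * codeg x x'.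
  under eq_bigr do rewrite mulr_sumr.
  rewrite exchange_big; apply: eq_bigr => x _ /=.
  rewrite /poormass mulr_sumr.
  under eq_bigr do rewrite mulr_sumr mulr_sumr.
  rewrite exchange_big; apply: eq_bigr => x' _ /=.
  rewrite /codeg mulr_sumr mulr_sumr; apply: eq_bigr => y _; ring.
apply: (@le_trans _ _ (\sum_(x <- s | high x) mu x * (d ^+ 3 / 128))).
  apply: ler_sum => x _; apply: ler_wpM2l => //.
  apply: (@le_trans _ _ (\sum_(x' <- s | poor x x') mu x' * (d ^+ 3 / 128))).
    by apply: ler_sum => x' /andP[_ /ltW ?]; exact: ler_wpM2l.
  rewrite -mulr_suml -[leRHS]mul1r ler_wpM2r//; apply: le_trans mu1.
  by apply: ler_sum_pred.
rewrite -mulr_suml -[leRHS]mul1r ler_wpM2r//; apply: le_trans mu1.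
by apply: ler_sum_pred.
Qed.

(** The [nu]-sum of [mass ^+ 2] minus [16 / d] times the poor weight is at least
    [d ^+ 2 / 4 - d ^+ 2 / 8]. As [nu] has total at most 1, some [y] has value at least
    [d ^+ 2 / 9], which yields both bounds at once. *)
Let pivot : exists y, d / 3 <= mass y /\
  \sum_(x <- s | high x) mu x * g x y * poormass x y <= d / 16 * mass y ^+ 2.
Proof.
have m0 y : 0 <= mass y by apply: sumr_ge0.
pose bad y := \sum_(x <- s | high x) mu x * g x y * poormass x y.
have bad0 y : 0 <= bad y.
  by apply: sumr_ge0 => x _; rewrite mulr_ge0//; apply: sumr_ge0.
pose F y := mass y ^+ 2 - bad y * (16 / d).
have SF : d ^+ 2 / 8 <= \sum_(y <- t) nu y * F y.
  have -> : \sum_(y <- t) nu y * F y = \sum_(y <- t) nu y * mass y ^+ 2 -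
     (\sum_(y <- t) nu y * bad y) * (16 / d).
    rewrite mulr_suml -sumrB; apply: eq_bigr => y _; rewrite /F; ring.
  have : (\sum_(y <- t) nu y * bad y) * (16 / d) <= d ^+ 3 / 128 * (16 / d).
    by rewrite ler_wpM2r// divr_ge0// ltW.
  have -> : d ^+ 3 / 128 * (16 / d) = d ^+ 2 / 8 by field; rewrite gt_eqF.
  by have := mass_sq; lra.
have [y Fy] : exists y, d ^+ 2 / 9 <= F y.
  apply: contrapT => /forallNP nF; move: SF; apply/negP; rewrite -ltNge.
  apply: (@le_lt_trans _ _ (\sum_(y <- t) nu y * (d ^+ 2 / 9))).
    apply: ler_sum => y _; apply: ler_wpM2l => //.
    by have /negP := nF y; rewrite -ltNge => /ltW.
  rewrite -mulr_suml; have d2 : 0 < d ^+ 2 by rewrite exprn_gt0.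
  apply: (@le_lt_trans _ _ (1 * (d ^+ 2 / 9))); last lra.
  by rewrite ler_wpM2r//; lra.
have bd : 0 <= bad y * (16 / d) by rewrite mulr_ge0// divr_ge0// ltW.
have d2 : 0 <= d ^+ 2 by rewrite sqr_ge0.
exists y; split.
  rewrite -ler_sqr ?nnegrE ?divr_ge0 ?(ltW d0)//.
  apply: (@le_trans _ _ (F y)); last by rewrite /F gerBl.
  by apply: le_trans Fy; rewrite le_eqVlt; apply/orP; left; apply/eqP; field.
have : bad y * (16 / d) <= mass y ^+ 2.
  by rewrite -subr_ge0; apply: le_trans Fy; lra.
move=> /(ler_wpM2l (_ : 0 <= d / 16)) -/(_ ltac:(by rewrite divr_ge0// ltW)).
by have -> : d / 16 * (bad y * (16 / d)) = bad y by field; rewrite gt_eqF.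
Qed.

Lemma balog_szemeredi_gowers : exists (P : pred I) (Q : pred J),
  [/\ d / 6 <= \sum_(x <- s | P x) mu x,
      d / 4 <= \sum_(y <- t | Q y) nu y
    & forall x y, P x -> Q y -> d ^+ 5 / 3072 <=
        \sum_(x1 <- s) \sum_(y1 <- t)
          mu x1 * nu y1 * (g x y1 * g x1 y1 * g x1 y)].
Proof.
have [z [mz bz]] := pivot.
set D := mass z in mz bz.
have D0 : 0 < D by have := d0; lra.
(* By [bz] and Markov's inequality, the high neighbours of [z] that are not light carry at most half
   of [D]. *)
pose light x := poormass x z <= d / 8 * D.
exists (fun x => high x && light x).
(* Every high vertex has degree at least [d / 2], so the sums defining [Q] have [nu]-total at least
   [d / 2 * D]. None exceeds [D], so those above [d / 4 * D] have [nu]-mass at least [d / 4]. *)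
pose Q y := d / 4 * D <= \sum_(x <- s | high x) mu x * g x z * g x y.
exists Q.
split.
- apply: (@le_trans _ _ (D / 2)); first by lra.
  apply: (@le_trans _ _ (\sum_(x <- s | high x && light x) mu x * g x z)).
    have : D = \sum_(x <- s | high x && light x) mu x * g x z +
               \sum_(x <- s | high x && ~~ light x) mu x * g x z.
      by rewrite /D /mass (bigID light).
    suff : \sum_(x <- s | high x && ~~ light x) mu x * g x z <= D / 2 by lra.
    rewrite -(@ler_pM2r _ (d / 8 * D)); last by rewrite mulr_gt0 ?divr_gt0.
    apply: (@le_trans _ _ (d / 16 * D ^+ 2)); last by lra.
    apply: le_trans bz; rewrite mulr_suml.
    apply: (@le_trans _ _ (\sum_(x <- s | high x && ~~ light x)
       mu x * g x z * poormass x z)).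
      by apply: ler_sum => x /andP[_]; rewrite -ltNge => /ltW ?; exact: ler_wpM2l.
    apply: ler_sum_pred => [x /andP[]//|x _].
    by rewrite mulr_ge0//; apply: sumr_ge0.
  by apply: ler_sum => x _; rewrite -[leRHS]mulr1 ler_wpM2l.
- pose f y := \sum_(x <- s | high x) mu x * g x z * g x y.
  have fD y : f y <= D.
    by apply: ler_sum => x _; rewrite -[leRHS]mulr1 ler_wpM2l.
  have Sf : d / 2 * D <= \sum_(y <- t) nu y * f y.
    have -> : \sum_(y <- t) nu y * f y =
       \sum_(x <- s | high x) mu x * g x z * deg x.
      under eq_bigr do rewrite mulr_sumr.
      rewrite exchange_big; apply: eq_bigr => x _ /=; rewrite mulr_sumr.
      by apply: eq_bigr => y _; ring.
    rewrite mulr_sumr; apply: ler_sum => x hx; rewrite mulrC.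
    exact: ler_wpM2l.
  rewrite (bigID Q) /= in Sf.
  have : \sum_(y <- t | ~~ Q y) nu y * f y <= d / 4 * D.
    have dD : 0 <= d / 4 * D by rewrite mulr_ge0 ?divr_ge0 ?ltW.
    apply: (@le_trans _ _ (\sum_(y <- t) nu y * (d / 4 * D))).
      apply: (@le_trans _ _ (\sum_(y <- t | ~~ Q y) nu y * (d / 4 * D))).
        by apply: ler_sum => y; rewrite -ltNge => /ltW ?; exact: ler_wpM2l.
      by apply: ler_sum_pred => // y _; exact: mulr_ge0.
    by rewrite -mulr_suml -[leRHS]mul1r ler_wpM2r.
  have : \sum_(y <- t | Q y) nu y * f y <= (\sum_(y <- t | Q y) nu y) * D.
    by rewrite mulr_suml; apply: ler_sum => y _; exact: ler_wpM2l.
  move=> h1 h2; rewrite -(ler_pM2r D0); lra.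
- move=> x y /andP[hx lx] Qy.
  have e0 : 0 <= d ^+ 3 / 128 by rewrite divr_ge0// exprn_ge0// ltW.
  (* Paths of length three [x - y1 - x1 - y]. Of the weight [d / 4 * D] of high [x1] joined to [z]
     and [y], at most [d / 8 * D] is poor with [x] because [x] is light. At least [d / 8 * (d / 3)]
     remains, with codegree at least [d ^+ 3 / 128]. *)
  apply: (@le_trans _ _ (\sum_(x1 <- s | high x1 && ~~ poor x x1)
      mu x1 * g x1 z * g x1 y * (d ^+ 3 / 128))); last first.
    apply: (@le_trans _ _ (\sum_(x1 <- s | high x1 && ~~ poor x x1)
      mu x1 * g x1 y * codeg x x1)).
      apply: ler_sum => x1 /andP[hx1]; rewrite /poor hx1 /= -leNgt => c1.
      apply: ler_pM => //; first by rewrite !mulr_ge0.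
      by rewrite -mulrA mulrCA -[leRHS]mul1r ler_wpM2r.
    apply: (@le_trans _ _ (\sum_(x1 <- s) mu x1 * g x1 y * codeg x x1)).
      by apply: ler_sum_pred => // x1 _; rewrite mulr_ge0.
    rewrite le_eqVlt; apply/orP; left; apply/eqP; apply: eq_bigr => x1 _.
    by rewrite mulr_sumr; apply: eq_bigr => y1 _; ring.
  rewrite -mulr_suml.
  have : \sum_(x1 <- s | high x1) mu x1 * g x1 z * g x1 y =
     \sum_(x1 <- s | high x1 && poor x x1) mu x1 * g x1 z * g x1 y +
     \sum_(x1 <- s | high x1 && ~~ poor x x1) mu x1 * g x1 z * g x1 y.
    by rewrite (bigID (poor x)).
  have : \sum_(x1 <- s | high x1 && poor x x1) mu x1 * g x1 z * g x1 y <= d / 8 * D.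
    apply: le_trans lx.
    apply: (@le_trans _ _ (\sum_(x1 <- s | high x1 && poor x x1) mu x1 * g x1 z)).
      by apply: ler_sum => x1 _; rewrite -[leRHS]mulr1 ler_wpM2l.
    by apply: ler_sum_pred => // x1 /andP[].
  move=> h1 h2.
  have h3 : d / 8 * (d / 3) <=
     \sum_(x1 <- s | high x1 && ~~ poor x x1) mu x1 * g x1 z * g x1 y.
    have : d / 8 * (d / 3) <= d / 8 * D by rewrite ler_wpM2l// divr_ge0 ?ltW.
    by move: Qy; rewrite /Q; lra.
  apply: le_trans (ler_wpM2r e0 h3).
  by rewrite le_eqVlt; apply/orP; left; apply/eqP; field.
Qed.

End BalogSzemerediGowers.

(** * Plunnecke's inequality, after Petridis *)

Definition sumset (G : zmodType) (S T : {fset G}) : {fset G} :=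
  [fset (x + y)%R | x in S, y in T]%fset.
Definition diffset (G : zmodType) (S T : {fset G}) : {fset G} :=
  [fset x - y | x in S, y in T]%fset.

Section Plunnecke.
Variable G : zmodType.
Implicit Types (S T Z B C : {fset G}).

Lemma sumsetP S T x :
  reflect (exists a b, [/\ a \in S, b \in T & x = a + b]) (x \in sumset S T).
Proof.
by apply: (iffP (imfset2P _ _ _ _ _)) => [[a aS [b bT ->]]|[a [b [aS bT ->]]]];
  [exists a, b | exists a => //; exists b].
Qed.

Lemma diffsetP S T x :
  reflect (exists a b, [/\ a \in S, b \in T & x = a - b]) (x \in diffset S T).
Proof.
by apply: (iffP (imfset2P _ _ _ _ _)) => [[a aS [b bT ->]]|[a [b [aS bT ->]]]];
  [exists a, b | exists a => //; exists b].
Qed.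

Lemma mem_sumset S T a b : a \in S -> b \in T -> a + b \in sumset S T.
Proof. by move=> aS bT; apply/sumsetP; exists a, b. Qed.

Lemma mem_diffset S T a b : a \in S -> b \in T -> a - b \in diffset S T.
Proof. by move=> aS bT; apply/diffsetP; exists a, b. Qed.

Lemma sumsetA S T Z : sumset S (sumset T Z) = sumset (sumset S T) Z.
Proof.
apply/fsetP => x; apply/sumsetP/sumsetP.
  move=> [a [_ [aS /sumsetP[b [c [bT cZ ->]]] ->]]].
  by exists (a + b), c; rewrite mem_sumset// addrA.
move=> [_ [c [/sumsetP[a [b [aS bT ->]]] cZ ->]]].
by exists a, (b + c); rewrite mem_sumset// addrA.
Qed.

Lemma card_translate S c : #|` [fset (x + c)%R | x in S]%fset| = #|` S|.
Proof. by rewrite card_imfset//= => x y /addIr. Qed.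

(** Fix for each difference [d] one representation [s - t]; then [(d, z)] maps to [(z + s, z + t)]
    injectively, since [d] is the difference of the two coordinates. Outside [diffset S T] the
    choice [(0, 0)] is a dummy. *)
Lemma ruzsa_triangle S T Z :
  (#|` diffset S T| * #|` Z| <= #|` sumset Z S| * #|` sumset Z T|)%N.
Proof.
have /choice[f fP] d : exists p : G * G,
    d \in diffset S T -> [/\ p.1 \in S, p.2 \in T & d = p.1 - p.2].
  case: (boolP (d \in diffset S T)) => [/diffsetP[a [b [? ? ?]]]|_].
    by exists (a, b).
  by exists (0, 0).
have szM (X Y : {fset G}) : (#|` X| * #|` Y|)%N =
    size [seq (x, y) | x <- X, y <- Y] by rewrite size_allpairs.
rewrite szM [leqRHS]szM.
rewrite -(size_map (fun q => (q.2 + (f q.1).1, q.2 + (f q.1).2))).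
apply: uniq_leq_size.
  rewrite map_inj_in_uniq; first by rewrite allpairs_uniq ?fset_uniq// => -[? ?] [].
  move=> _ _ /allpairsP[[d z] /= [dST zZ ->]] /allpairsP[[d' z'] /= [dST' zZ' ->]].
  move=> [e1 e2].
  have [_ _ fd] := fP _ dST; have [_ _ fd'] := fP _ dST'.
  have dd : d = d'.
    rewrite fd fd'.
    have cancelz u p q : p - q = (u + p) - (u + q) :> G.
      by rewrite opprD addrACA subrr add0r.
    by rewrite (cancelz z) e1 e2 -cancelz.
  by rewrite -dd in e1 *; rewrite (addIr _ e1).
move=> _ /mapP[_ /allpairsP[[d z] /= [dST zZ ->]] ->] /=.
have [fS fT _] := fP _ dST.
by apply/allpairsP; exists (z + (f d).1, z + (f d).2); rewrite !mem_sumset.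
Qed.

Section Petridis.
Variables (R : realFieldType) (Z B : {fset G}) (k : R).
Hypothesis Zmin : forall Z', (Z' `<=` Z)%fset ->
  k * #|` Z'|%:R <= #|` sumset Z' B|%:R.
Hypothesis Zeq : #|` sumset Z B|%:R = k * #|` Z|%:R.

Lemma petridis C : #|` sumset (sumset Z B) C|%:R <= k * #|` sumset Z C|%:R.
Proof.
have s0 S : sumset S fset0 = fset0.
  by apply/fsetP => x; rewrite in_fset0; apply/sumsetP => -[a [b []]].
have sU S C' c : sumset S (c |` C')%fset =
    (sumset S C' `|` [fset (x + c)%R | x in S])%fset.
  apply/fsetP => x; rewrite in_fsetU; apply/sumsetP/orP.
    move=> [a [b [aS /fset1UP[->|bC] ->]]]; last by left; exact: mem_sumset.
    by right; apply/imfsetP; exists a.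
  case=> [/sumsetP[a [b [aS bC ->]]]|/imfsetP[a /= aS ->]].
    by exists a, b; rewrite in_fset1U bC orbT.
  by exists a, c; rewrite in_fset1U eqxx.
have [n] := ubnP #|` C|; elim: n C => // n IHn C; rewrite ltnS => Cn.
have [->|/fset0Pn[c cC]] := eqVneq C fset0; first by rewrite !s0 cardfs0 mulr0.
have IH := IHn (C `\ c)%fset; move: Cn; rewrite (cardfsD1 c) cC add1n => /IH.
rewrite -[in X in _ -> X](fsetD1K cC); move: (C `\ c)%fset => C' {IH IHn} IH.
(* Adding [c] to [C'] enlarges [Z + C'] by exactly [|Z| - |Z'|]. Since [Z' + B + c] already lies in
   [Z + B + C'], the set [Z + B + C'] grows by at most [|Z + B| - |Z' + B|], which is at most
   [k (|Z| - |Z'|)] by minimality. *)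
pose Z' := [fset z in Z | (z + c)%R \in sumset Z C']%fset.
have Z'Z : (Z' `<=` Z)%fset by apply/fsubsetP => z; rewrite !inE => /andP[].
have cardU S T U : (U `<=` S `&` T)%fset ->
    #|` (S `|` T)%fset|%:R <= #|` S|%:R + #|` T|%:R - #|` U|%:R :> R.
  move=> /fsubset_leq_card ST; rewrite lerBrDr -!natrD ler_nat -(cardfsUI S T).
  by rewrite leq_add2l.
rewrite !sU.
have e1 : (#|` sumset Z C'|%:R + #|` Z|%:R - #|` Z'|%:R : R) =
    #|` (sumset Z C' `|` [fset (x + c)%R | x in Z])%fset|%:R.
  rewrite -(card_translate Z c) -(card_translate Z' c) -natrD -cardfsUI natrD.
  rewrite -addrA.
  suff -> : (sumset Z C' `&` [fset (x + c)%R | x in Z])%fset =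
            [fset (x + c)%R | x in Z']%fset by rewrite subrr addr0.
  apply/fsetP => x; rewrite in_fsetI; apply/andP/imfsetP => /=.
    by move=> [xZ /imfsetP[z /= zZ ez]]; exists z => //; rewrite !inE zZ -ez.
  by move=> [z]; rewrite !inE => /andP[zZ zc] ->; split=> //; apply/imfsetP; exists z.
rewrite -e1 mulrBr mulrDr -Zeq.
apply: (le_trans (cardU _ _ [fset (x + c)%R | x in sumset Z' B]%fset _)).
  apply/fsubsetP => _ /imfsetP[_ /= /sumsetP[z [b [+ bB ->]]] ->].
  rewrite !inE => /andP[zZ /sumsetP[z1 [c1 [z1Z c1C e]]]].
  apply/andP; split; last by apply/imfsetP; exists (z + b) => //; apply: mem_sumset.
  by rewrite addrAC e addrAC; do 2?apply: mem_sumset.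
rewrite !card_translate; have := Zmin Z'Z; lra.
Qed.

End Petridis.

Fixpoint nsumset (n : nat) (B : {fset G}) : {fset G} :=
  if n is n'.+1 then sumset B (nsumset n' B) else [fset 0]%fset.

Lemma sum_in_nsumset n B (a : 'I_n -> G) :
  (forall i, a i \in B) -> \sum_(i < n) a i \in nsumset n B.
Proof.
elim: n a => [|n IH] a aB; first by rewrite big_ord0 /= inE.
by rewrite big_ord_recl /=; apply: mem_sumset => //; apply: IH.
Qed.

Lemma sumdiff_diffset n m B :
  (sumdiff n m B `<=` diffset (nsumset n B) (nsumset m B))%fset.
Proof.
apply/fsubsetP => x /sumdiffP[a [b [aB bB ->]]].
by apply: mem_diffset; apply: sum_in_nsumset.
Qed.

(** Descent on the size of [S]: if [S] is not itself minimal, a nonempty proper subset has a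
    strictly smaller ratio. *)
Lemma exists_min_ratio (R : realFieldType) S B : S != fset0 ->
  exists Z, [/\ Z != fset0, (Z `<=` S)%fset,
    #|` sumset Z B|%:R / #|` Z|%:R <= #|` sumset S B|%:R / #|` S|%:R :> R
    & forall Z', (Z' `<=` Z)%fset ->
      #|` sumset Z B|%:R / #|` Z|%:R * #|` Z'|%:R <= #|` sumset Z' B|%:R :> R].
Proof.
pose q S : R := #|` sumset S B|%:R / #|` S|%:R.
have [n] := ubnP #|` S|; elim: n S => // n IHn S; rewrite ltnS => Sn S0.
have [Smin|] := pselect (forall Z', (Z' `<=` S)%fset -> q S * #|` Z'|%:R <= #|` sumset Z' B|%:R).
  by exists S.
move=> /existsNP[Z' /not_implyP[Z'S /negP]]; rewrite -ltNge => lt.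
have Z'0 : Z' != fset0.
  by apply: contraTneq lt => ->; rewrite cardfs0 mulr0 -leNgt.
have qZ' : q Z' < q S by rewrite /q ltr_pdivrMr// ltr0n cardfs_gt0.
have Z'n : (#|` Z'| < n)%N.
  apply: leq_trans Sn; apply: fproper_ltn_card; rewrite fproperEneq Z'S andbT.
  by apply: contraTneq qZ' => ->; rewrite ltxx.
have [Z [Z0 ZZ' qZ Zmin]] := IHn _ Z'n Z'0.
exists Z; split=> //; first exact: fsubset_trans Z'S.
by apply: le_trans qZ _; exact: ltW.
Qed.

(** For a subset [Z] of [Y] minimizing the growth ratio, Petridis's inequality iterates to
    [|Z + jB| <= q ^+ j |Z|]; Ruzsa's triangle inequality through [Z] then handles the
    difference. *)
Lemma plunnecke_ruzsa (R : realFieldType) (n m : nat) Y B (k : R) :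
  Y != fset0 -> #|` sumset Y B|%:R <= k * #|` Y|%:R ->
  #|` sumdiff n m B|%:R <= k ^+ (n + m) * #|` Y|%:R.
Proof.
move=> Y0 YB; have [Z [Z0 ZY qZ Zmin]] := exists_min_ratio R B Y0.
set q := _ / _ in qZ Zmin.
have Zpos : 0 < #|` Z|%:R :> R by rewrite ltr0n cardfs_gt0.
have q0 : 0 <= q by rewrite divr_ge0.
have qk : q <= k.
  by apply: le_trans qZ _; rewrite ler_pdivrMr// ltr0n cardfs_gt0.
have Zeq : #|` sumset Z B|%:R = q * #|` Z|%:R by rewrite divfK ?gt_eqF.
have ZnB j : #|` sumset Z (nsumset j B)|%:R <= q ^+ j * #|` Z|%:R.
  elim: j => [|j IH] /=.
    rewrite expr0 mul1r ler_nat -[leqRHS](card_translate Z 0).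
    apply: fsubset_leq_card; apply/fsubsetP => _ /sumsetP[a [b [aZ /fset1P -> ->]]].
    by apply/imfsetP; exists a.
  rewrite sumsetA exprS -mulrA; apply: (le_trans (petridis Zmin Zeq _)).
  exact: ler_wpM2l.
have := ruzsa_triangle (nsumset n B) (nsumset m B) Z.
rewrite -(ler_nat R) !natrM => tri.
have sub := fsubset_leq_card (sumdiff_diffset n m B).
apply: (@le_trans _ _ (q ^+ (n + m) * #|` Z|%:R)); last first.
  apply: ler_pM; rewrite ?exprn_ge0 ?ler_nat ?fsubset_leq_card//.
  by apply: lerXn2r; rewrite ?nnegrE// (le_trans q0 qk).
rewrite -(ler_pM2r Zpos).
apply: (@le_trans _ _ ((q ^+ n * #|` Z|%:R) * (q ^+ m * #|` Z|%:R))); last first.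
  by rewrite exprD le_eqVlt; apply/orP; left; apply/eqP; ring.
apply: le_trans (ler_pM _ _ (ZnB n) (ZnB m)) => //.
by apply: le_trans tri; rewrite ler_wpM2r// ler_nat.
Qed.

End Plunnecke.

(** * The representation function *)

Section Representation.
Variables (R : realFieldType) (G : zmodType) (A : {fset G}).

Definition ind (x : G) : R := (x \in A)%:R.
Definition rep (x : G) : R := \sum_(p <- A) ind (p - x).

Local Notation D := (diffset A A).

Lemma ind_ge0 x : 0 <= ind x. Proof. exact: ler0n. Qed.

Lemma rep_ge0 x : 0 <= rep x.
Proof. by apply: sumr_ge0 => p _; exact: ind_ge0. Qed.

Lemma sum_pred1_fset (S : {fset G}) y : \sum_(q <- S) (q == y)%:R = (y \in S)%:R :> R.
Proof.
have [yS|yS] := boolP (y \in S).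
  by rewrite (bigD1_seq y) ?fset_uniq//= eqxx big1 ?addr0// => q /negPf ->.
by rewrite big_seq big1// => q qS; case: eqP => // qy; rewrite -qy qS in yS.
Qed.

(** With [ind] expanded into Kronecker deltas, both sides are double sums over [A] that differ by
    exchanging the two points. *)
Lemma rep_opp x : rep (- x) = rep x.
Proof.
rewrite /rep /ind; under eq_bigr do rewrite -sum_pred1_fset.
rewrite exchange_big /=; apply: eq_bigr => q _.
rewrite -sum_pred1_fset; apply: eq_bigr => p _; congr (_ %:R).
by rewrite opprK [in RHS]eq_sym subr_eq.
Qed.

Lemma repE x : rep x = #|` A `&` translate A x|%fset%:R.
Proof.
rewrite -rep_opp /rep /ind -natr_sum; congr (_ %:R).
rewrite (_ : \sum_(p <- A) _ = size [seq p <- A | (p + x)%R \in A])%N; last first.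
  rewrite size_filter -sum1_count [RHS]big_mkcond; apply: eq_bigr => p _.
  by rewrite opprK; case: ifP.
apply: perm_size; apply: uniq_perm; rewrite ?filter_uniq ?fset_uniq// => p.
rewrite mem_filter in_fsetI andbC; case: (p \in A) => //=.
apply/idP/imfsetP => /= [pxA|[a aA ->]]; last by rewrite subrK.
by exists (p + x); rewrite ?addrK.
Qed.

(** Change of variable [t = a - p]. As [a] lies in [A], every such [t] lies in [D], so restricting
    the sum to [D] loses nothing. *)
Lemma slice a (f : G -> R) : a \in A ->
  \sum_(t <- D) ind (a - t) * f t = \sum_(p <- A) f (a - p).
Proof.
move=> aA.
transitivity (\sum_(x <- [seq a - p | p <- A]) f x); last by rewrite big_map.
transitivity (\sum_(t <- D | a - t \in A) f t).
  by rewrite [RHS]big_mkcond; apply: eq_bigr => t _ /=; rewrite /ind mulr_natl mulrb.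
rewrite -big_filter; apply: perm_big; apply: uniq_perm.
- by rewrite filter_uniq// fset_uniq.
- by rewrite map_inj_uniq ?fset_uniq// => p q /addrI /oppr_inj.
move=> x; rewrite mem_filter; apply/andP/mapP.
  by move=> [axA xD]; exists (a - x) => //; rewrite subKr.
by move=> [p pA ->]; rewrite subKr mem_diffset.
Qed.

Lemma sum_ind_ind a c : a \in A ->
  \sum_(t <- D) ind (a - t) * ind (c - t) = rep (a - c).
Proof.
move=> aA; rewrite slice//; apply: eq_bigr => p _; congr ind.
by rewrite !opprB addrCA.
Qed.

Lemma sum_sub (f : G -> R) :
  \sum_(a <- A) \sum_(b <- A) f (a - b) = \sum_(x <- D) rep x * f x.
Proof.
under [RHS]eq_bigr do rewrite mulr_suml.
rewrite [RHS]exchange_big /= [LHS]big_seq [RHS]big_seq; apply: eq_bigr => a aA.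
by rewrite slice.
Qed.

Lemma sum_sub_sub (f : G -> G -> R) :
  \sum_(a <- A) \sum_(b <- A) \sum_(c <- A) f (a - b) (a - c) =
  \sum_(x <- D) \sum_(y <- D) (\sum_(a <- A) ind (a - x) * ind (a - y)) * f x y.
Proof.
have step a : a \in A -> \sum_(b <- A) \sum_(c <- A) f (a - b) (a - c) =
    \sum_(x <- D) \sum_(y <- D) ind (a - x) * ind (a - y) * f x y.
  move=> aA; rewrite -(slice (fun x => \sum_(c <- A) f x (a - c)))//.
  apply: eq_bigr => x _; rewrite -(slice (f x))// mulr_sumr.
  by apply: eq_bigr => y _; rewrite mulrA.
rewrite big_seq (eq_bigr _ step) -big_seq exchange_big; apply: eq_bigr => x _ /=.
by rewrite exchange_big; apply: eq_bigr => y _ /=; rewrite mulr_suml.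
Qed.

Lemma rep_out x : x \notin D -> rep x = 0.
Proof.
move=> xD; rewrite /rep big_seq big1// => p pA; rewrite /ind.
case: (boolP (p - x \in A)) => // pxA; case/negP: xD.
by rewrite -(subKr p x) mem_diffset.
Qed.

Lemma energy_rep k : (0 < k)%N -> (energy k A)%:R = \sum_(x <- D) rep x ^+ k :> R.
Proof.
by move=> k0; rewrite energyE// natr_sum; apply: eq_bigr => x _; rewrite repE natrX.
Qed.

Local Notation E2 := (\sum_(x <- D) rep x ^+ 2).
Local Notation E3 := (\sum_(x <- D) rep x ^+ 3).
Local Notation N := (#|` A|%:R : R).

Lemma sum_rep : \sum_(x <- D) rep x = N ^+ 2.
Proof.
under eq_bigr do rewrite -[rep _]mulr1.
rewrite -(sum_sub (fun=> 1)) big_const_seq count_predT iter_addr_0.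
by rewrite big_const_seq count_predT iter_addr_0 -[LHS]mulr_natl expr2.
Qed.

(* [E3] counts pairs of triples in [A] with the same differences [a - b], [a - c]. *)
Lemma sum_triples_sq (f : G -> G -> R) :
  (\sum_(a <- A) \sum_(b <- A) \sum_(c <- A) f (a - b) (a - c)) ^+ 2 <=
  E3 * \sum_(x <- D) \sum_(y <- D) f x y ^+ 2.
Proof.
rewrite sum_sub_sub; apply: (le_trans (cauchy_schwarz_sum2 _ _ _ _)).
rewrite le_eqVlt; apply/orP; left; apply/eqP; congr (_ * _).
transitivity (\sum_(a <- A) \sum_(a' <- A) rep (a - a') ^+ 2); last first.
  by rewrite (sum_sub (fun x => rep x ^+ 2)); apply: eq_bigr => x _; rewrite exprS.
under eq_bigr do under eq_bigr do rewrite expr2 big_distrlr /=.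
under eq_bigr do rewrite exchange_big /=.
rewrite exchange_big /= big_seq [RHS]big_seq; apply: eq_bigr => a aA.
under eq_bigr do rewrite exchange_big /=.
rewrite exchange_big /=; apply: eq_bigr => a' _.
rewrite -sum_ind_ind// expr2 big_distrlr /=; apply: eq_bigr => x _.
by apply: eq_bigr => y _; ring.
Qed.

(* The matrix [rep (b - c)] is the Gram matrix of the vectors [t |-> ind (b - t)]; testing the
   sum of squares obtained from it against [rep t] gives the bound. *)
Lemma triangle_lower_bound (u : G -> R) :
  (forall x, 0 <= u x <= rep x) -> (forall x, u (- x) = u x) ->
  (\sum_(a <- A) \sum_(b <- A) u (a - b)) ^+ 4 <= N ^+ 3 * E2 *
    \sum_(a <- A) \sum_(b <- A) \sum_(c <- A) u (a - b) * u (a - c) * rep (b - c).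
Proof.
move=> urep uN; have u0 x : 0 <= u x by case/andP: (urep x).
pose H a t := \sum_(b <- A) u (a - b) * ind (b - t).
set W := (X in _ <= _ * X).
have WE : W = \sum_(a <- A) \sum_(t <- D) H a t ^+ 2.
  apply: eq_bigr => a _.
  under [RHS]eq_bigr do rewrite expr2 big_distrlr /=.
  rewrite [RHS]exchange_big big_seq [RHS]big_seq; apply: eq_bigr => b bA /=.
  rewrite [RHS]exchange_big; apply: eq_bigr => c _ /=.
  by rewrite -sum_ind_ind// mulr_sumr; apply: eq_bigr => t _; ring.
pose e b := \sum_(a <- A) u (a - b).
have e0 b : 0 <= e b by apply: sumr_ge0.
set S := \sum_(a <- A) \sum_(b <- A) u (a - b).
have Se : S = \sum_(b <- A) e b by rewrite /S exchange_big.
have S0 : 0 <= S by rewrite Se sumr_ge0.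
have cs1 : S ^+ 2 <= N * \sum_(b <- A) e b ^+ 2.
  have := cauchy_schwarz_sum A (fun=> 1) e.
  under eq_bigr do rewrite mul1r.
  under [X in _ <= X * _]eq_bigr do rewrite expr1n.
  by rewrite big_const_seq count_predT iter_addr_0 -Se.
have cs2 : (\sum_(b <- A) e b ^+ 2) ^+ 2 <= W * (N * E2).
  have := cauchy_schwarz_sum2 A D H (fun _ t => rep t).
  rewrite -WE [X in _ <= _ * X]big_const_seq count_predT iter_addr_0.
  rewrite -[(\sum_(x <- D) _) *+ _]mulr_natl.
  move=> h; apply: (le_trans _ h); rewrite ler_sqr ?nnegrE; last 2 first.
  - by apply: sumr_ge0 => b _; rewrite sqr_ge0.
  - apply: sumr_ge0 => a _; apply: sumr_ge0 => t _; rewrite mulr_ge0 ?rep_ge0//.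
    by apply: sumr_ge0 => b _; rewrite mulr_ge0 ?ind_ge0.
  have -> : \sum_(a <- A) \sum_(t <- D) H a t * rep t =
     \sum_(b <- A) e b * \sum_(p <- A) rep (b - p).
    transitivity (\sum_(a <- A) \sum_(b <- A) u (a - b) * \sum_(p <- A) rep (b - p)).
      apply: eq_bigr => a _; under eq_bigr do rewrite mulr_suml.
      rewrite exchange_big big_seq [RHS]big_seq; apply: eq_bigr => b bA /=.
      rewrite -slice// mulr_sumr; apply: eq_bigr => t _; ring.
    by rewrite exchange_big; apply: eq_bigr => b _ /=; rewrite mulr_suml.
  (* Since [u] is even and bounded by [rep], [e b] is at most the sum of [rep (b - p)]. *)
  apply: ler_sum => b _; rewrite expr2 ler_wpM2l//.
  apply: ler_sum => p _; rewrite -opprB uN.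
  by case/andP: (urep (b - p)).
have N0 : 0 <= N by [].
have S4 : S ^+ 4 <= (N * \sum_(b <- A) e b ^+ 2) ^+ 2.
  rewrite (_ : 4 = 2 * 2)%N// exprM ler_sqr ?nnegrE ?sqr_ge0//.
  by apply: le_trans cs1; rewrite sqr_ge0.
apply: le_trans S4 _; rewrite exprMn.
apply: (@le_trans _ _ (N ^+ 2 * (W * (N * E2)))); first by rewrite ler_wpM2l ?sqr_ge0.
by rewrite le_eqVlt; apply/orP; left; apply/eqP; ring.
Qed.

End Representation.

(** * From triangles to structure *)

(** Shifting a variable may push it out of [D]; this costs nothing when the summand vanishes
    there. *)
Lemma ler_sum_reindex (R : numDomainType) (I J : eqType) (s : seq I) (t : seq J)
    (h : I -> J) (F : J -> R) : uniq s -> injective h ->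
  (forall z, 0 <= F z) -> (forall z, z \notin t -> F z = 0) -> uniq t ->
  \sum_(x <- s) F (h x) <= \sum_(z <- t) F z.
Proof.
move=> us hinj F0 Ft ut.
rewrite -(big_map h predT F) (bigID (mem t)) /= [X in _ + X]big1 ?addr0//.
rewrite -big_filter [leRHS](bigID (mem (map h s))) /= -[X in _ <= X + _]big_filter.
rewrite (perm_big [seq z <- t | z \in map h s]).
  by rewrite lerDl sumr_ge0.
apply: uniq_perm; rewrite ?filter_uniq ?map_inj_uniq// => z.
by rewrite !mem_filter andbC.
Qed.

Lemma sumr_card (R : pzRingType) (K : choiceType) (S : {fset K}) (P : pred K) :
  \sum_(x <- S) (P x)%:R = #|` [fset x in S | P x]%fset|%:R :> R.
Proof.
rewrite -natr_sum; congr (_ %:R).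
transitivity (size [seq x <- S | P x]).
  by rewrite size_filter -sum1_count [RHS]big_mkcond.
by apply: perm_size; apply: uniq_perm; rewrite ?filter_uniq ?fset_uniq// => x;
  rewrite mem_filter !inE andbC.
Qed.

Lemma leq_card_sumset (G : zmodType) (S T : {fset G}) :
  T != fset0 -> (#|` S| <= #|` sumset S T|)%N.
Proof.
move=> /fset0Pn[t tT]; rewrite -(card_translate S t); apply: fsubset_leq_card.
by apply/fsubsetP => _ /imfsetP[x /= xS ->]; exact: mem_sumset.
Qed.

Lemma exists_ge_average (R : realFieldType) (I : choiceType) (s : {fset I})
    (F : I -> R) (c : R) : s != fset0 ->
  #|` s|%:R * c <= \sum_(i <- s) F i -> exists2 i, i \in s & c <= F i.
Proof.
move=> /fset0Pn[i0 i0s] h; apply: contrapT => nF.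
have lt i : i \in s -> F i < c.
  by move=> si; rewrite ltNge; apply/negP => ?; apply: nF; exists i.
move: h; apply/negP; rewrite -ltNge.
have -> : #|` s|%:R * c = \sum_(i <- s) c.
  by rewrite big_const_seq count_predT iter_addr_0 mulr_natl.
rewrite (bigD1_seq i0) ?fset_uniq//= [ltRHS](bigD1_seq i0) ?fset_uniq//=.
rewrite ltr_leD ?lt// big_seq_cond [leRHS]big_seq_cond.
by apply: ler_sum => i /andP[/lt /ltW].
Qed.

Definition cut (R : realFieldType) (t x : R) : R := if x <= t then x else 0.

Section Cut.
Variables (R : realFieldType) (t : R).
Hypothesis t0 : 0 < t.

Lemma cut_ge0 x : 0 <= x -> 0 <= cut t x.
Proof. by rewrite /cut; case: ifP. Qed.

Lemma cut_le x : 0 <= x -> cut t x <= x.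
Proof. by rewrite /cut; case: ifP. Qed.

Lemma cut_bound x : cut t x <= t.
Proof. by rewrite /cut; case: ifP => // _; exact: ltW. Qed.

(** Only values [x > t] are lost, and for them [x ^+ 2 <= x ^+ 3 / t]; summed over [r], this bounds
    the truncation loss by [E3 / t]. *)
Lemma cut_tail x : 0 <= x -> x * (x - cut t x) <= x ^+ 3 / t.
Proof.
move=> x0; rewrite /cut; case: ifPn => [_|]; first by rewrite subrr mulr0 divr_ge0 ?exprn_ge0// ltW.
rewrite -ltNge subr0 => tx; rewrite ler_pdivlMr// exprSr -expr2.
by rewrite ler_wpM2l ?sqr_ge0// ltW.
Qed.
End Cut.

Section Structure.
Variables (R : realFieldType) (G : zmodType) (A : {fset G}).
Local Notation D := (diffset A A).
Local Notation r := (@rep R G A).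
Local Notation E2 := (\sum_(x <- D) r x ^+ 2).
Local Notation E3 := (\sum_(x <- D) r x ^+ 3).
Local Notation N := (#|` A|%:R : R).

(** [triangle_lower_bound] applies with [u] the truncation of [r] at [t1]. Truncating the third
    factor loses at most [t1 ^+ 2 * (r - cut t3 r)] per triple; for each of the [N] choices of [a]
    this sums to at most [t1 ^+ 2 * (E3 / t3)] by [cut_tail]. *)
Lemma triangles_cut (t1 t3 b : R) : 0 < t1 -> 0 < t3 -> b <= 1 ->
  (1 - b) * E2 <= \sum_(x <- D) r x * cut t1 (r x) ->
  (1 - b) ^+ 4 * E2 ^+ 4 <= N ^+ 3 * E2 *
    (\sum_(a <- A) \sum_(b <- A) \sum_(c <- A)
       cut t1 (r (a - b)) * cut t1 (r (a - c)) * cut t3 (r (b - c))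
     + N * t1 ^+ 2 * (E3 / t3)).
Proof.
move=> t10 t30 b1; rewrite -(sum_sub A (fun x => cut t1 (r x))) => hb.
have E20 : 0 <= E2 by apply: sumr_ge0 => x _; rewrite sqr_ge0.
have ur x : 0 <= cut t1 (r x) <= r x by rewrite cut_ge0 ?cut_le ?rep_ge0.
have uN x : cut t1 (r (- x)) = cut t1 (r x) by rewrite rep_opp.
have tri := triangle_lower_bound ur uN.
rewrite -exprMn.
apply: (@le_trans _ _ ((\sum_(a <- A) \sum_(b <- A) cut t1 (r (a - b))) ^+ 4)).
  by apply: lerXn2r; rewrite ?nnegrE ?mulr_ge0 ?subr_ge0//; apply: le_trans hb;
    rewrite mulr_ge0 ?subr_ge0.
apply: le_trans tri _; rewrite ler_wpM2l ?mulr_ge0//.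
have -> : N * t1 ^+ 2 * (E3 / t3) =
  \sum_(a <- A) (t1 ^+ 2 * (\sum_(x <- D) r x ^+ 3 / t3)).
  rewrite big_const_seq count_predT iter_addr_0 -[RHS]mulr_natl -mulr_suml; ring.
rewrite -big_split; apply: ler_sum => a _ /=.
apply: (@le_trans _ _ (\sum_(b <- A) \sum_(c <- A)
     (cut t1 (r (a - b)) * cut t1 (r (a - c)) * cut t3 (r (b - c)) +
      t1 ^+ 2 * (r (b - c) - cut t3 (r (b - c)))))).
  apply: ler_sum => b' _; apply: ler_sum => c _.
  set x := cut t1 _; set y := cut t1 _; set z := cut t3 _.
  have xy : x * y <= t1 ^+ 2.
    by rewrite expr2 ler_pM ?cut_ge0 ?rep_ge0 ?cut_bound.
  have : 0 <= (t1 ^+ 2 - x * y) * (r (b' - c) - z).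
    by rewrite mulr_ge0 ?subr_ge0 ?cut_le ?rep_ge0.
  lra.
under [leLHS]eq_bigr do rewrite big_split /=.
rewrite big_split /= lerD2l.
under [leLHS]eq_bigr do rewrite -mulr_sumr.
rewrite -mulr_sumr ler_wpM2l ?sqr_ge0//.
rewrite (sum_sub A (fun x => r x - cut t3 (r x))).
by apply: ler_sum => x _; rewrite cut_tail ?rep_ge0.
Qed.

(** Here [d] is the edge density fed to the Balog-Szemeredi-Gowers lemma: Cauchy-Schwarz gives
    [w ^+ 2 / E3], and normalizing vertex and edge weights divides by [E2 ^+ 2] and [t3 ^+ 2]. *)
Lemma structure_of_triangles (t1 t3 w : R) : A != fset0 -> 0 < t1 -> 0 < t3 -> 0 < w ->
  0 < E2 -> 0 < E3 ->
  w <= \sum_(a <- A) \sum_(b <- A) \sum_(c <- A)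
         cut t1 (r (a - b)) * cut t1 (r (a - c)) * cut t3 (r (b - c)) ->
  let d := w ^+ 2 / (E3 * E2 ^+ 2 * t3 ^+ 2) in
  exists A' : {fset G}, [/\ (A' `<=` A)%fset,
    d * E2 / (6 * t1 * N) <= #|` A'|%:R
  & forall n m, #|` sumdiff n m A'|%:R <=
      (12288 * t1 ^+ 6 / (t3 ^+ 6 * d ^+ 6)) ^+ (n + m) *
      (3072 * E2 * t1 ^+ 4 / (d ^+ 5 * t3 ^+ 6))].
Proof.
move=> A0 t10 t30 w0 E20 E30 hw d.
pose u x := cut t1 (r x); pose v x := cut t3 (r x).
have u0 x : 0 <= u x by rewrite cut_ge0 ?rep_ge0.
have v0 x : 0 <= v x by rewrite cut_ge0 ?rep_ge0.
have ut x : u x <= t1 by rewrite cut_bound.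
have vt x : v x <= t3 by rewrite cut_bound.
have ur x : u x <= r x by rewrite cut_le ?rep_ge0.
have vr x : v x <= r x by rewrite cut_le ?rep_ge0.
have d0 : 0 < d by rewrite divr_gt0 ?mulr_gt0 ?exprn_gt0.
have N0 : 0 < N by rewrite ltr0n cardfs_gt0.
have usum : \sum_(x <- D) u x ^+ 2 <= E2.
  by apply: ler_sum => x _; rewrite lerXn2r ?nnegrE ?rep_ge0.
have vsum : \sum_(x <- D) v x ^+ 2 <= E2.
  by apply: ler_sum => x _; rewrite lerXn2r ?nnegrE ?rep_ge0.
have big : w ^+ 2 / E3 <= \sum_(x <- D) \sum_(y <- D) (u x * u y * v (y - x)) ^+ 2.
  rewrite ler_pdivrMr// mulrC.
  apply: (le_trans _ (sum_triples_sq A (fun x y => u x * u y * v (y - x)))).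
  have -> : \sum_(a <- A) \sum_(b <- A) \sum_(c <- A)
      u (a - b) * u (a - c) * v (a - c - (a - b)) =
    \sum_(a <- A) \sum_(b <- A) \sum_(c <- A) u (a - b) * u (a - c) * v (b - c).
    apply: eq_bigr => a _; apply: eq_bigr => b _; apply: eq_bigr => c _.
    by rewrite opprB [X in v X]addrC addrA subrK.
  by rewrite lerXn2r ?nnegrE ?(ltW w0)// (le_trans (ltW w0)).
pose mu x := u x ^+ 2 / E2.
pose g x y := v (y - x) ^+ 2 / t3 ^+ 2.
have mu0 x : 0 <= mu x by rewrite divr_ge0 ?sqr_ge0// ltW.
have g01 x y : 0 <= g x y <= 1.
  rewrite divr_ge0 ?sqr_ge0//= ler_pdivrMr ?exprn_gt0// mul1r.
  by rewrite lerXn2r ?nnegrE// ltW.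
have mu1 : \sum_(x <- D) mu x <= 1 by rewrite -mulr_suml ler_pdivrMr// mul1r.
have dg : d <= \sum_(x <- D) \sum_(y <- D) mu x * mu y * g x y.
  have -> : \sum_(x <- D) \sum_(y <- D) mu x * mu y * g x y =
    (\sum_(x <- D) \sum_(y <- D) (u x * u y * v (y - x)) ^+ 2) / (E2 ^+ 2 * t3 ^+ 2).
    rewrite mulr_suml; apply: eq_bigr => x _; rewrite mulr_suml.
    by apply: eq_bigr => y _; rewrite /mu /g; field; rewrite !gt_eqF.
  rewrite ler_pdivlMr ?mulr_gt0 ?exprn_gt0//; apply: le_trans big.
  by rewrite le_eqVlt; apply/orP; left; apply/eqP; rewrite /d; field; rewrite !gt_eqF.
have [P [Q [muP muQ path]]] := balog_szemeredi_gowers mu0 mu0 g01 mu1 mu1 d0 dg.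
pose X := [fset x in D | P x]%fset.
pose Y := [fset y in D | Q y]%fset.
pose f x := v x ^+ 2.
have f0 x : 0 <= f x by exact: sqr_ge0.
have fD x : x \notin D -> f x = 0.
  by move=> xD; rewrite /f /v rep_out// /cut ltW// expr0n.
pose S := diffset X Y.
(* The path bound with the weights unnormalized: three edges give [t3 ^+ 6], and the two inner
   vertices have [mu]-product at most [t1 ^+ 4 / E2 ^+ 2]. *)
pose m := d ^+ 5 / 3072 * (E2 ^+ 2 * t3 ^+ 6 / t1 ^+ 4).
have m0 : 0 < m by rewrite /m; positivity.
(* Every difference in [X - Y] has weight at least [m] as a combination of three elements of
   the support of [f]. *)
have popular s : s \in S ->
    m <= \sum_(z1 <- D) \sum_(z2 <- D) f z1 * f z2 * f (z2 - z1 - s).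
  move=> /diffsetP[x [y [+ + ->]]]; rewrite !inE => /andP[_ Px] /andP[_ Qy].
  have h1 : m <= \sum_(x1 <- D) \sum_(y1 <- D) f (y1 - x) * f (y1 - x1) * f (y - x1).
    rewrite /m -ler_pdivlMr; last by positivity.
    apply: le_trans (path x y Px Qy) _.
    rewrite mulr_suml; apply: ler_sum => x1 _; rewrite mulr_suml; apply: ler_sum => y1 _.
    have -> : mu x1 * mu y1 * (g x y1 * g x1 y1 * g x1 y) =
      (u x1 ^+ 2 * u y1 ^+ 2) * (f (y1 - x) * f (y1 - x1) * f (y - x1) / (E2 ^+ 2 * t3 ^+ 6)).
      by rewrite /mu /g /f; field; rewrite !gt_eqF.
    have -> : f (y1 - x) * f (y1 - x1) * f (y - x1) / (E2 ^+ 2 * t3 ^+ 6 / t1 ^+ 4) =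
      (t1 ^+ 2 * t1 ^+ 2) * (f (y1 - x) * f (y1 - x1) * f (y - x1) / (E2 ^+ 2 * t3 ^+ 6)).
      by field; rewrite !gt_eqF.
    rewrite ler_wpM2r//.
      by rewrite divr_ge0 ?mulr_ge0 ?exprn_ge0 ?(ltW E20) ?(ltW t30).
    by rewrite ler_pM ?sqr_ge0// lerXn2r ?nnegrE ?(ltW t10).
  apply: le_trans h1 _; rewrite exchange_big /=.
  (* Substitute [z1 = y1 - x] and [z2 = y1 - x1]; the third edge is then
     [y - x1 = z2 - z1 - (x - y)]. *)
  pose F z1 := f z1 * \sum_(z2 <- D) f z2 * f (z2 - z1 - (x - y)).
  apply: (@le_trans _ _ (\sum_(y1 <- D) F (y1 - x))).
    apply: ler_sum => y1 _; under eq_bigr do rewrite -mulrA.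
    rewrite -mulr_sumr ler_wpM2l//.
    have -> : \sum_(x1 <- D) f (y1 - x1) * f (y - x1) =
       \sum_(x1 <- D) (fun z => f z * f (z - (y1 - x) - (x - y))) (y1 - x1).
      apply: eq_bigr => x1 _ /=; congr (_ * f _).
      rewrite !opprB; have -> : y1 - x1 + (x - y1) = x - x1 by rewrite addrC addrA subrK.
      by rewrite [RHS]addrC addrA subrK.
    apply: (@ler_sum_reindex _ _ _ _ _ (fun x1 => y1 - x1)); rewrite ?fset_uniq //=.
    - by move=> a b /addrI /oppr_inj.
    - by move=> z; rewrite mulr_ge0.
    - by move=> z /fD ->; rewrite mul0r.
  apply: (@le_trans _ _ (\sum_(z <- D) F z)).
    apply: (@ler_sum_reindex _ _ _ _ _ (fun y1 => y1 - x)); rewrite ?fset_uniq //=.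
    - by move=> a b /addIr.
    - by move=> z; rewrite mulr_ge0// sumr_ge0// => z2 _; rewrite mulr_ge0.
    - by move=> z /fD; rewrite /F => ->; rewrite mul0r.
  apply: ler_sum => z1 _; rewrite /F mulr_sumr; apply: ler_sum => z2 _.
  by rewrite mulrA.
(* Sum [popular] over [S]: for fixed [z1], [z2] the points [z2 - z1 - s] are distinct, so each of
   the three factors sums to at most [E2]. *)
have cardS : #|` S|%:R * m <= E2 ^+ 3.
  have -> : #|` S|%:R * m = \sum_(s <- S) m.
    by rewrite big_const_seq count_predT iter_addr_0 -[RHS]mulr_natl.
  apply: (@le_trans _ _ (\sum_(s <- S)
     \sum_(z1 <- D) \sum_(z2 <- D) f z1 * f z2 * f (z2 - z1 - s))).
    by rewrite big_seq [leRHS]big_seq; exact: ler_sum.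
  rewrite exchange_big /=; under eq_bigr do rewrite exchange_big /=.
  apply: (@le_trans _ _ (\sum_(z1 <- D) \sum_(z2 <- D) f z1 * f z2 * E2)).
    apply: ler_sum => z1 _; apply: ler_sum => z2 _; rewrite -mulr_sumr.
    rewrite ler_wpM2l ?mulr_ge0//; apply: le_trans vsum.
    apply: (@ler_sum_reindex _ _ _ _ _ (fun s => z2 - z1 - s)); rewrite ?fset_uniq //=.
    by move=> a b /addrI /oppr_inj.
  rewrite (_ : \sum_(z1 <- D) _ = (\sum_(z <- D) f z) ^+ 2 * E2).
    rewrite [leRHS]exprSr ler_wpM2r ?(ltW E20)// lerXn2r ?nnegrE ?(ltW E20)//.
    by rewrite sumr_ge0.
  rewrite expr2 big_distrlr mulr_suml; apply: eq_bigr => z1 _.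
  by rewrite mulr_suml.
have cardS' : #|` S|%:R <= 3072 * E2 * t1 ^+ 4 / (d ^+ 5 * t3 ^+ 6).
  rewrite -ler_pdivlMr// in cardS; apply: le_trans cardS _.
  by rewrite le_eqVlt; apply/orP; left; apply/eqP; rewrite /m; field; rewrite !gt_eqF.
(* One point has [mu]-mass at most [t1 ^+ 2 / E2], while [Q] has mass at least [d / 4]. *)
have cardY : d * E2 / (4 * t1 ^+ 2) <= #|` Y|%:R.
  rewrite ler_pdivrMr ?mulr_gt0 ?exprn_gt0//.
  rewrite /Y -(sumr_card R D Q).
  have : \sum_(y <- D | Q y) mu y <= (\sum_(y <- D) (Q y)%:R) * (t1 ^+ 2 / E2).
    rewrite mulr_suml [leLHS]big_mkcond; apply: ler_sum => y _ /=.
    case: (Q y); last by rewrite mul0r.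
    by rewrite mul1r ler_wpM2r ?invr_ge0 ?(ltW E20)// lerXn2r ?nnegrE ?(ltW t10).
  move=> /(le_trans muQ); rewrite mulrA ler_pdivlMr//; lra.
(* Average over [a0]: the total is the sum of [r] over [X], and [u ^+ 2 <= t1 * r] converts the
   [mu]-mass [d / 6] into a lower bound for it. *)
have [a0 a0A cardT] : exists2 a0, a0 \in A &
    d * E2 / (6 * t1 * N) <= #|` [fset a in A | a - a0 \in X]%fset|%:R.
  apply: exists_ge_average => //.
  have -> : N * (d * E2 / (6 * t1 * N)) = d / 6 * E2 / t1 by field; rewrite !gt_eqF.
  have -> : \sum_(a0 <- A) #|` [fset a in A | a - a0 \in X]%fset|%:R =
     \sum_(x <- D) r x * (x \in X)%:R.
    rewrite -(sum_sub A (fun x => (x \in X)%:R)) exchange_big.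
    by apply: eq_bigr => a0 _; rewrite sumr_card.
  rewrite ler_pdivrMr// -ler_pdivlMr//; apply: le_trans muP _.
  rewrite [leLHS]big_mkcond mulr_suml mulr_suml [leLHS]big_seq [leRHS]big_seq.
  apply: ler_sum => x xD; rewrite !inE xD /=; case: (P x); last by rewrite mulr0 !mul0r.
  rewrite mulr1 ler_wpM2r ?invr_ge0 ?(ltW E20)// expr2.
  by rewrite ler_pM.
pose A' := [fset a in A | a - a0 \in X]%fset.
exists A'; split=> //; first by apply/fsubsetP => a; rewrite !inE => /andP[].
have A'0 : A' != fset0.
  rewrite -cardfs_gt0 -(ltr0n R); apply: lt_le_trans cardT.
  by positivity.
(* Plunnecke's inequality is stated for sums, so [Y] is negated; then [Y' + A'] lies in the
   translate of [X - Y] by [a0]. *)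
pose Y' := [fset - y | y in Y]%fset.
have cY' : #|` Y'| = #|` Y| by rewrite card_imfset//; exact: oppr_inj.
have Y'0 : Y' != fset0.
  rewrite -cardfs_gt0 cY' -(ltr0n R); apply: lt_le_trans cardY.
  by positivity.
have sumS : (#|` sumset Y' A'| <= #|` S|)%N.
  rewrite -(card_translate S a0); apply: fsubset_leq_card; apply/fsubsetP => z.
  move=> /sumsetP[_ [a [/imfsetP[y /= yY ->] + ->]]].
  rewrite !inE => /andP[aA aX].
  apply/imfsetP; exists (a - a0 - y).
    by apply: mem_diffset => //; rewrite !inE.
  by rewrite addrAC subrK addrC.
move=> n k.
have := @plunnecke_ruzsa G R n k Y' A' (12288 * t1 ^+ 6 / (t3 ^+ 6 * d ^+ 6)) Y'0.
have sumS' : #|` sumset Y' A'|%:R <= 3072 * E2 * t1 ^+ 4 / (d ^+ 5 * t3 ^+ 6).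
  by apply: le_trans cardS'; rewrite ler_nat.
have s0 : 0 <= 12288 * t1 ^+ 6 / (t3 ^+ 6 * d ^+ 6).
  by positivity.
move=> plun; apply: le_trans (plun _) _; last first.
  rewrite ler_wpM2l ?exprn_ge0//.
  by apply: le_trans sumS'; rewrite ler_nat leq_card_sumset.
apply: le_trans sumS' _; rewrite cY'.
apply: le_trans (ler_wpM2l s0 cardY).
by rewrite le_eqVlt; apply/orP; left; apply/eqP; field; rewrite !gt_eqF.
Qed.

End Structure.

(** * Energies normalized by K and M *)

Section Normalized.
Variables (R : realFieldType) (G : zmodType) (A : {fset G}) (K M : R).
Local Notation D := (diffset A A).
Local Notation r := (@rep R G A).
Local Notation N := (#|` A|%:R : R).
Local Notation E2 := (\sum_(x <- D) r x ^+ 2).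
Local Notation E3 := (\sum_(x <- D) r x ^+ 3).
Hypothesis A0 : A != fset0.
Hypothesis E2K : E2 = N ^+ 3 / K.
Hypothesis E3M : E3 = M * N ^+ 4 / K ^+ 2.

Lemma card_gt0R : 0 < N. Proof. by rewrite ltr0n cardfs_gt0. Qed.

(** Cauchy-Schwarz and the total [N ^+ 2] of [r] force [E2 > 0]. This also excludes [K = 0], where
    the quotient would be 0 by convention. *)
Lemma energy_param_gt0 : 0 < K.
Proof.
have N0 := card_gt0R.
have E20 : 0 <= E2 by apply: sumr_ge0 => x _; rewrite sqr_ge0.
have := cauchy_schwarz_sum D (fun=> 1) r.
under eq_bigr do rewrite mul1r.
rewrite sum_rep; have [->|E2n] := eqVneq E2 0.
  by rewrite mulr0 leNgt !exprn_gt0.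
have : 0 < E2 by rewrite lt_neqAle eq_sym E2n.
by rewrite E2K pmulr_rgt0 ?exprn_gt0// invr_gt0.
Qed.

Let K0 := energy_param_gt0.
Let N0 := card_gt0R.

(** Under the probability weight [r / N ^+ 2], [r] has mean [N / K] and relative variance
    [M - 1]. *)
Lemma variance_rep :
  \sum_(x <- D) r x * (r x - N / K) ^+ 2 = (M - 1) * N ^+ 4 / K ^+ 2.
Proof.
have -> : \sum_(x <- D) r x * (r x - N / K) ^+ 2 =
    E3 - 2 * (N / K) * E2 + (N / K) ^+ 2 * \sum_(x <- D) r x.
  rewrite !mulr_sumr -sumrB -big_split; apply: eq_bigr => x _ /=; ring.
by rewrite sum_rep E2K E3M; field; rewrite gt_eqF.
Qed.

Lemma moment_param_ge1 : 1 <= M.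
Proof.
have : 0 <= (M - 1) * N ^+ 4 / K ^+ 2.
  rewrite -variance_rep; apply: sumr_ge0 => x _.
  by rewrite mulr_ge0 ?rep_ge0 ?sqr_ge0.
by rewrite -mulrA pmulr_lge0 ?subr_ge0// divr_gt0 ?exprn_gt0.
Qed.

Let M1 := moment_param_ge1.
Let M0 : 0 < M. Proof. exact: lt_le_trans ltr01 M1. Qed.

(** [t1] makes [E3 / t1 = E2 / 4], and [t3] makes the loss [N * t1 ^+ 2 * (E3 / t3)] equal to one
    ninth of [N ^+ 6 / K ^+ 3]. *)
Let t1 := 4 * M * (N / K).
Let t3 := 144 * M ^+ 3 * (N / K).
Let t10 : 0 < t1. Proof. by rewrite /t1; positivity. Qed.
Let t30 : 0 < t3. Proof. by rewrite /t3; positivity. Qed.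

Let cut_sum : \sum_(x <- D) r x * cut t1 (r x) =
  E2 - \sum_(x <- D) r x * (r x - cut t1 (r x)).
Proof. by rewrite -sumrB; apply: eq_bigr => x _; ring. Qed.

Lemma cut_sum_ge : (1 - 1 / 4) * E2 <= \sum_(x <- D) r x * cut t1 (r x).
Proof.
suff : \sum_(x <- D) r x * (r x - cut t1 (r x)) <= E2 / 4 by rewrite cut_sum; lra.
apply: (@le_trans _ _ (E3 / t1)).
  by rewrite mulr_suml; apply: ler_sum => x _; rewrite cut_tail ?rep_ge0.
rewrite le_eqVlt; apply/orP; left; apply/eqP.
by rewrite E2K E3M /t1; field; rewrite !gt_eqF.
Qed.

(* Since the mean of [r] is [N / K], values above [4 N / K] are controlled by the variance. *)
Lemma cut_sum_ge_small : M <= 5 / 4 ->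
  (1 - 1 / 9) * E2 <= \sum_(x <- D) r x * cut t1 (r x).
Proof.
move=> M54.
suff : \sum_(x <- D) r x * (r x - cut t1 (r x)) <= E2 / 9 by rewrite cut_sum; lra.
apply: (@le_trans _ _ (4 / 9 * (K / N) * ((M - 1) * N ^+ 4 / K ^+ 2))).
  rewrite -variance_rep mulr_sumr; apply: ler_sum => x _.
  rewrite mulrCA ler_wpM2l ?rep_ge0//.
  have NK : 0 < N / K by rewrite divr_gt0.
  rewrite /cut; case: ifPn => [_|].
    by rewrite subrr mulr_ge0 ?sqr_ge0//; positivity.
  rewrite -ltNge subr0 /t1 => lt; set n := N / K in NK lt *.
  have -> : K / N = n^-1 by rewrite /n invf_div.
  have h : 4 * n <= r x.
    by apply: ltW; apply: le_lt_trans lt; rewrite ler_wpM2r ?(ltW NK)//; have := M1; lra.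
  rewrite mulrAC ler_pdivlMr//.
  (* With [x = r x], the claim [x n <= 4/9 (x - n)^2] is [(x - 4n)(4x - n) >= 0]; equality at
     [x = 4n] fixes the factor [4 / 9]. *)
  have := mulr_ge0 (_ : 0 <= r x - 4 * n) (_ : 0 <= 4 * r x - n).
  move=> /(_ ltac:(lra) ltac:(lra)); lra.
have -> : 4 / 9 * (K / N) * ((M - 1) * N ^+ 4 / K ^+ 2) = 4 / 9 * (M - 1) * E2.
  by rewrite E2K; field; rewrite !gt_eqF.
rewrite mulrC ler_wpM2l//; first by rewrite sumr_ge0// => x _; rewrite sqr_ge0.
lra.
Qed.

(** In units of [N ^+ 6 / K ^+ 3], at least [(1 - b) ^+ 4] triangles survive the first truncation
    and [w] remains after losing [1 / 9]. The density becomes [w ^+ 2 / (144 ^+ 2 * M ^+ 7)], whence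
    the powers of [M]. *)
Lemma structure_normalized (b w : R) : b <= 1 -> 0 < w ->
  w + 1 / 9 <= (1 - b) ^+ 4 ->
  (1 - b) * E2 <= \sum_(x <- D) r x * cut t1 (r x) ->
  exists A' : {fset G}, [/\ (A' `<=` A)%fset,
    w ^+ 2 / (24 * 144 ^+ 2) * (M ^- 8 * N) <= #|` A'|%:R
  & forall n m, #|` sumdiff n m A'|%:R <=
      (12288 * 4 ^+ 6 * 144 ^+ 6 / w ^+ 12 * M ^+ 30) ^+ (n + m) *
      (3072 * 4 ^+ 4 * 144 ^+ 4 * 24 * 144 ^+ 2 / w ^+ 12 * (M ^+ 29 * (K * #|` A'|%:R)))].
Proof.
move=> b1 w0 wb hb.
have E20 : 0 < E2 by rewrite E2K; positivity.
have E30 : 0 < E3 by rewrite E3M; positivity.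
have := triangles_cut t10 t30 b1 hb.
set T := \sum_(a <- A) _ => hT.
have wT : w * N ^+ 6 / K ^+ 3 <= T.
  have e : N * t1 ^+ 2 * (E3 / t3) = 1 / 9 * (N ^+ 6 / K ^+ 3).
    by rewrite E3M /t1 /t3; field; rewrite !gt_eqF.
  have e' : N ^+ 3 * E2 * (N ^+ 6 / K ^+ 3) = E2 ^+ 4.
    by rewrite E2K; field; rewrite !gt_eqF.
  rewrite e -e' mulrCA ler_pM2l in hT; last by rewrite mulr_gt0 ?exprn_gt0.
  have h : (w + 1 / 9) * (N ^+ 6 / K ^+ 3) <= (1 - b) ^+ 4 * (N ^+ 6 / K ^+ 3).
    by rewrite ler_wpM2r// divr_ge0 ?exprn_ge0 ?(ltW K0).
  by rewrite -mulrA; lra.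
have w'0 : 0 < w * N ^+ 6 / K ^+ 3 by positivity.
have [A' [A'A cA' dA']] := structure_of_triangles A0 t10 t30 w'0 E20 E30 wT.
set d := _ / (E3 * _ * _) in cA' dA'.
have dE : d = w ^+ 2 / (144 ^+ 2 * M ^+ 7).
  by rewrite /d E2K E3M /t3; field; rewrite !gt_eqF.
have cA : w ^+ 2 / (24 * 144 ^+ 2) * (M ^- 8 * N) <= #|` A'|%:R.
  apply: le_trans cA'; rewrite le_eqVlt; apply/orP; left; apply/eqP.
  by rewrite dE E2K /t1; field; rewrite !gt_eqF.
exists A'; split=> // n m; apply: (le_trans (dA' n m)).
have -> : 12288 * t1 ^+ 6 / (t3 ^+ 6 * d ^+ 6) =
    12288 * 4 ^+ 6 * 144 ^+ 6 / w ^+ 12 * M ^+ 30.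
  by rewrite dE /t1 /t3; field; rewrite !gt_eqF.
apply: ler_wpM2l.
  by positivity.
(* The bound is of order [M ^+ 21 * K * N]; trading [N] for [|A'|] costs a further [M ^+ 8]. *)
have -> : 3072 * E2 * t1 ^+ 4 / (d ^+ 5 * t3 ^+ 6) =
    3072 * 4 ^+ 4 * 144 ^+ 4 * 24 * 144 ^+ 2 / w ^+ 12 *
    (M ^+ 29 * (K * (w ^+ 2 / (24 * 144 ^+ 2) * (M ^- 8 * N)))).
  by rewrite dE E2K /t1 /t3; field; rewrite !gt_eqF.
apply: ler_wpM2l; first by positivity.
by rewrite !ler_wpM2l ?exprn_ge0 ?(ltW M0) ?(ltW K0).
Qed.

End Normalized.

(** * Logarithms, numerical constants and the conclusion *)

Lemma ln2_gt0 (R : realType) : 0 < ln (2 : R).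
Proof. by rewrite ln_gt0// ltr1n. Qed.

Lemma log2_ge (R : realType) (p q : nat) (x : R) : (0 < q)%N -> 0 < x ->
  2 ^+ p <= x ^+ q -> p%:R / q%:R <= log2 x.
Proof.
move=> q0 x0 px; rewrite /log2 ler_pdivrMr ?ltr0n// mulrAC ler_pdivlMr ?ln2_gt0//.
by rewrite mulr_natl mulr_natr -!lnXn// ler_ln ?posrE ?exprn_gt0.
Qed.

Lemma log2_4_ge2 (R : realType) (M : R) : 1 <= M -> 2 <= log2 (4 * M).
Proof.
move=> M1; have -> : 2 = 2%:R / 1%:R :> R by rewrite divr1.
by apply: log2_ge => //; rewrite ?expr1; lra.
Qed.

(** Here [4 * M >= 5], and [5 ^+ 4 = 625] exceeds [2 ^+ 9 = 512]. *)
Lemma log2_4_ge (R : realType) (M : R) : 5 / 4 <= M -> 9 / 4 <= log2 (4 * M).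
Proof.
move=> M1; apply: (@log2_ge R 9 4) => //; first lra.
apply: (@le_trans _ _ (5 ^+ 4)); first lra.
by apply: lerXn2r; rewrite ?nnegrE; lra.
Qed.

Lemma const_bound_small (R : realFieldType) (L : R) : 2 <= L ->
  12288 * 4 ^+ 6 * 144 ^+ 6 / (1 / 2) ^+ 12 <= L ^+ 84.
Proof.
move=> L2; apply: (@le_trans _ _ (2 ^+ 84)); first lra.
by apply: lerXn2r; rewrite ?nnegrE//; lra.
Qed.

Lemma const_bound_large (R : realFieldType) (L : R) : 9 / 4 <= L ->
  12288 * 4 ^+ 6 * 144 ^+ 6 / (1 / 5) ^+ 12 <= L ^+ 84.
Proof.
move=> L2; have L6 : 128 <= L ^+ 6.
  apply: (@le_trans _ _ ((9 / 4) ^+ 6)); first lra.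
  by apply: lerXn2r; rewrite ?nnegrE//; lra.
apply: (@le_trans _ _ (128 ^+ 14)); first lra.
by rewrite (_ : 84 = 6 * 14)%N// exprM; apply: lerXn2r; rewrite ?nnegrE//; lra.
Qed.

(** The target has [M ^+ (54 * k)]: [30 * k] is spent on the Plunnecke factor, and the spare
    [24 * k] covers the single [M ^+ 29] because [k >= 2]. The powers of [L], with [84 = 14 * 6],
    absorb [s ^+ k]. *)
Lemma sumdiff_bound_numeric (R : realFieldType) (M L s c c' Z : R) (k : nat) :
  1 <= M -> 0 <= s -> s <= L ^+ 84 -> 0 <= c -> c <= c' -> 0 <= Z -> 0 <= L -> (2 <= k)%N ->
  (s * M ^+ 30) ^+ k * (c * (M ^+ 29 * Z)) <=
  c' * ((M ^+ 9 * L ^+ 14) ^+ (6 * k) * Z).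
Proof.
move=> M1 s0 sL c0 cc Z0 L0 k2; have M0 : 0 <= M by exact: le_trans ler01 M1.
have -> : (M ^+ 9 * L ^+ 14) ^+ (6 * k) = (L ^+ 84) ^+ k * (M ^+ 30) ^+ k * M ^+ (24 * k).
  rewrite exprM [(_ * _) ^+ 6]exprMn -!exprM exprMn -!exprM mulrC -mulrA -exprD.
  by congr (_ * M ^+ _); rewrite -mulnDl.
have -> : (s * M ^+ 30) ^+ k * (c * (M ^+ 29 * Z)) =
  c * (s ^+ k * (M ^+ 30) ^+ k * M ^+ 29 * Z) by rewrite exprMn; ring.
have Mk : M ^+ 29 <= M ^+ (24 * k).
  by rewrite ler_weXn2l// (leq_trans (_ : _ <= 24 * 2)%N)// leq_mul2l.
have sk : s ^+ k <= (L ^+ 84) ^+ k by rewrite lerXn2r ?nnegrE ?exprn_ge0.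
apply: ler_pM => //; first by rewrite !mulr_ge0 ?exprn_ge0.
rewrite ler_wpM2r// ler_pM ?mulr_ge0 ?exprn_ge0//.
by rewrite ler_wpM2r ?exprn_ge0.
Qed.

Theorem theorem10 (R : realType) :
  exists c C : R, [/\ 0 < c, 0 < C &
    forall (G : zmodType) (A : {fset G}) (K M : R),
      A != fset0 ->
      (energy 2 A)%:R = #|` A|%:R ^+ 3 / K ->
      (energy 3 A)%:R = M * #|` A|%:R ^+ 4 / K ^+ 2 ->
      exists A' : {fset G},
        [/\ (A' `<=` A)%fset,
            c * (M ^- 10 * log2 (4 * M) ^- 15 * #|` A|%:R) <= #|` A'|%:R
          & forall n m : nat, (0 < n)%N -> (0 < m)%N ->
              #|` sumdiff n m A'|%:R <=
                C * ((M ^+ 9 * log2 (4 * M) ^+ 14) ^+ (6 * (n + m))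
                       * K * #|` A'|%:R)]].
Proof.
(* Both constants come from [w = 1 / 5], the weaker of the two cases. *)
pose c : R := (1 / 5) ^+ 2 / (24 * 144 ^+ 2).
pose C : R := 3072 * 4 ^+ 4 * 144 ^+ 4 * 24 * 144 ^+ 2 / (1 / 5) ^+ 12.
have c0 : 0 < c by rewrite /c; positivity.
have C0 : 0 < C by rewrite /C; positivity.
exists c, C; split=> //.
move=> G A K M A0 hE2 hE3.
rewrite (energy_rep R A (isT : (0 < 2)%N)) in hE2.
rewrite (energy_rep R A (isT : (0 < 3)%N)) in hE3.
have K0 := energy_param_gt0 A0 hE2.
have M1 := moment_param_ge1 A0 hE2 hE3.
have M0 : 0 < M by exact: lt_le_trans ltr01 M1.
set L := log2 (4 * M); have L2 : 2 <= L by exact: log2_4_ge2.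
have L0 : 0 < L by exact: lt_le_trans L2.
have finish (q s e : R) : c <= q -> 0 <= s -> s <= L ^+ 84 -> 0 <= e -> e <= C ->
    (exists A' : {fset G}, [/\ (A' `<=` A)%fset,
      q * (M ^- 8 * #|` A|%:R) <= #|` A'|%:R
    & forall n m, #|` sumdiff n m A'|%:R <=
        (s * M ^+ 30) ^+ (n + m) * (e * (M ^+ 29 * (K * #|` A'|%:R)))]) ->
    exists A' : {fset G},
        [/\ (A' `<=` A)%fset,
            c * (M ^- 10 * L ^- 15 * #|` A|%:R) <= #|` A'|%:R
          & forall n m : nat, (0 < n)%N -> (0 < m)%N ->
              #|` sumdiff n m A'|%:R <=
                C * ((M ^+ 9 * L ^+ 14) ^+ (6 * (n + m)) * K * #|` A'|%:R)].
  move=> cq s0 sL e0 eC [A' [A'A cA dA]]; exists A'; split=> // [|n m n0 m0].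
    apply: le_trans cA; apply: ler_pM => //; first exact: ltW.
      by rewrite !mulr_ge0 ?invr_ge0 ?exprn_ge0 ?(ltW M0) ?(ltW L0).
    rewrite ler_wpM2r// -[leRHS]mulr1; apply: ler_pM.
    - by rewrite invr_ge0 exprn_ge0 ?(ltW M0).
    - by rewrite invr_ge0 exprn_ge0 ?(ltW L0).
    - by rewrite lef_pV2 ?posrE ?exprn_gt0// ler_weXn2l.
    - by rewrite invf_le1 ?exprn_gt0// exprn_ege1// (le_trans _ L2)// ler1n.
  apply: (le_trans (dA n m)); rewrite -[X in _ <= _ * X]mulrA.
  apply: (sumdiff_bound_numeric M1 s0 sL e0 eC _ (ltW L0)).
    by rewrite mulr_ge0// ltW.
  by case: n m n0 m0 => [|n] [|m]// _ _; rewrite addSn addnS.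
have p5 : 0 < (1 / 5 : R) by positivity.
have p2 : 0 < (1 / 2 : R) by positivity.
have lt52 : (1 / 5 : R) <= 1 / 2 by rewrite ler_pM2l// lef_pV2 ?posrE// ler_nat.
(* For small [M], [(8 / 9) ^+ 4 >= 1 / 2 + 1 / 9] allows [w = 1 / 2]; otherwise
   [(3 / 4) ^+ 4 >= 1 / 5 + 1 / 9] allows [w = 1 / 5], and the larger constant is absorbed by
   [L >= 9 / 4]. *)
have [M54|/ltW M54] := leP M (5 / 4).
  have hb : (1 - 1 / 9) * (\sum_(x <- diffset A A) rep R A x ^+ 2) <= _ :=
    cut_sum_ge_small A0 hE2 hE3 M54.
  have := structure_normalized A0 hE2 hE3 _ p2 _ hb.
  move=> /(_ ltac:(clear; lra) ltac:(clear; lra)); apply: finish.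
  - by rewrite /c ler_pM2r; [rewrite lerXn2r ?nnegrE ?(ltW p2) ?(ltW p5)|positivity].
  - by positivity.
  - exact: const_bound_small.
  - by positivity.
  - rewrite /C ler_pM2l; last by positivity.
    by rewrite lef_pV2 ?posrE ?exprn_gt0// lerXn2r ?nnegrE ?(ltW p2) ?(ltW p5).
have := structure_normalized A0 hE2 hE3 _ p5 _ (cut_sum_ge A0 hE2 hE3).
move=> /(_ ltac:(clear; lra) ltac:(clear; lra)); apply: finish.
- exact: lexx.
- by positivity.
- exact/const_bound_large/log2_4_ge.
- by positivity.
- exact: lexx.
Qed.
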